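(* Let $N\ge 1$ and let $\Omega=\Omega^{(L)}\cup\Omega^{(R)}$ be a planar two-patch domain described by an analysis-suitable $G^1$ two-patch geometry $\mathbf F$. Let $\Phi^\ell$, $\ell=0,\dots,N-1$, be the level-$\ell$ sets of $C^1$ isogeometric functions on $\Omega$, constructed on dyadically refined knot vectors as described in the context. Let $\Omega=\Omega^0\supseteq\Omega^1\supseteq\dots\supseteq\Omega^{N-1}$ be a sequence of closed nested domains, and put $\Omega^N=\emptyset$. Define $$\mathcal W=\bigl\{\phi\in\Phi^\ell:\ 0\le \ell\le N-1,\ \operatorname{supp}^0\phi\subseteq\Omega^\ell\ \wedge\ \operatorname{supp}^0\phi\not\subseteq\Omega^{\ell+1}\bigr\},\qquad \mathbb W_H=\operatorname{span}\mathcal W,$$ where $\operatorname{supp}^0\phi=\operatorname{supp}\phi\cap\Omega^0$. Then $\mathcal W$ is a basis for the $C^1$ hierarchical space $\mathbb W_H$.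
   Context: Univariate splines. Let $k,p,r$ be positive integers with $p\ge 3$ and $1\le r\le p-2$, and let $0<\tau_1<\tau_2<\dots<\tau_k<1$ be internal breakpoints. Level $0$ uses these breakpoints: $k^0=k$, $\tau_i^0=\tau_i$. For $\ell\ge 1$, the breakpoints $\tau_1^\ell<\dots<\tau_{k^\ell}^\ell$ of level $\ell$ are obtained from those of level $\ell-1$ by dyadic refinement (adding the midpoint of every knot span of $[0,1]$), so $k^\ell=2k^{\ell-1}+1$. Let $\mathbb S_p^{r,\ell}$ be the space of splines on $[0,1]$ of degree $p$ with respect to the open knot vector in which $0$ and $1$ have multiplicity $p+1$ and each internal breakpoint $\tau_i^\ell$ has multiplicity $p-r$ (so the splines are $C^r$); its B-splines are $N_{i,p}^{r,\ell}$, $i\in\mathbf I^\ell=\{0,\dots,n^\ell-1\}$, $n^\ell=p+1+k^\ell(p-r)$. Let $\mathbb S_p^{r+1,\ell}$ (degree $p$, regularity $r+1$) and $\mathbb S_{p-1}^{r,\ell}$ (degree $p-1$, regularity $r$) be the analogous spaces with the same internal breakpoints, with B-splines $N_{i,p}^{r+1,\ell}$, $i\in\mathbf I_0^\ell=\{0,\dots,n_0^\ell-1\}$, $n_0^\ell=p+1+k^\ell(p-r-1)$, and $N_{i,p-1}^{r,\ell}$, $i\in\mathbf I_1^\ell=\{0,\dots,n_1^\ell-1\}$, $n_1^\ell=p+k^\ell(p-r-1)$. Geometry. $\mathbf F^{(L)},\mathbf F^{(R)}\in(\mathbb S_p^{r,0}\otimes\mathbb S_p^{r,0})^2$ are regular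 bijective maps $\mathbf F^{(S)}:[0,1]^2\to\Omega^{(S)}\subset\mathbb R^2$, $S\in\{L,R\}$. The patches share one whole edge $\Gamma=\Omega^{(L)}\cap\Omega^{(R)}$, parameterized by $\mathbf F_0(\xi_2)=\mathbf F^{(L)}(0,\xi_2)=\mathbf F^{(R)}(0,\xi_2)$, $\xi_2\in[0,1]$. The pair $\mathbf F=(\mathbf F^{(L)},\mathbf F^{(R)})$ is analysis-suitable $G^1$ if there are linear functions (polynomials of degree at most one) $\alpha^{(S)},\beta^{(S)}:[0,1]\to\mathbb R$, $S\in\{L,R\}$, with $\alpha^{(L)},\alpha^{(R)}$ relatively prime, such that for all $\xi_2\in[0,1]$: $\alpha^{(L)}(\xi_2)\alpha^{(R)}(\xi_2)<0$, and, with $\beta=\alpha^{(L)}\beta^{(R)}-\alpha^{(R)}\beta^{(L)}$, $$\alpha^{(R)}(\xi_2)\partial_1\mathbf F^{(L)}(0,\xi_2)-\alpha^{(L)}(\xi_2)\partial_1\mathbf F^{(R)}(0,\xi_2)+\beta(\xi_2)\partial_2\mathbf F^{(L)}(0,\xi_2)=\mathbf 0 .$$ Among the admissible linear functions, those minimizing $\|\alpha^{(L)}+1\|_{L^2([0,1])}^2+\|\alpha^{(R)}-1\|_{L^2([0,1])}^2$ and $\|\beta^{(L)}\|_{L^2([0,1])}^2+\|\beta^{(R)}\|_{L^2([0,1])}^2$ are fixed once and for all (for all levels). Functions of level $\ell$. $\Phi^\ell=\Phi^\ell_{\Omega^{(L)}}\cup\Phi^\ell_{\Omega^{(R)}}\cup\Phi^\ell_{\Gamma_0}\cup\Phi^\ell_{\Gamma_1}$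 is a set of functions on $\Omega$, defined through their compositions with $\mathbf F^{(S)}$, $S\in\{L,R\}$: (1) $\Phi^\ell_{\Omega^{(S')}}=\{\phi^{\Omega^{(S')},\ell}_{i,j}: i\in\mathbf I^\ell\setminus\{0,1\},\ j\in\mathbf I^\ell\}$, $S'\in\{L,R\}$, where $(\phi^{\Omega^{(S')},\ell}_{i,j}\circ\mathbf F^{(S)})(\xi_1,\xi_2)=N_{i,p}^{r,\ell}(\xi_1)N_{j,p}^{r,\ell}(\xi_2)$ if $S=S'$ and $0$ otherwise; (2) $\Phi^\ell_{\Gamma_0}=\{\phi^{\Gamma_0,\ell}_i:i\in\mathbf I_0^\ell\}$, where for $S\in\{L,R\}$ $$(\phi^{\Gamma_0,\ell}_i\circ\mathbf F^{(S)})(\xi_1,\xi_2)=N_{i,p}^{r+1,\ell}(\xi_2)\bigl(N_{0,p}^{r,\ell}(\xi_1)+N_{1,p}^{r,\ell}(\xi_1)\bigr)+\beta^{(S)}(\xi_2)\bigl(N_{i,p}^{r+1,\ell}\bigr)'(\xi_2)\tfrac{\tau_1^\ell}{p}N_{1,p}^{r,\ell}(\xi_1);$$ (3) $\Phi^\ell_{\Gamma_1}=\{\phi^{\Gamma_1,\ell}_i:i\in\mathbf I_1^\ell\}$, where for $S\in\{L,R\}$ $$(\phi^{\Gamma_1,\ell}_i\circ\mathbf F^{(S)})(\xi_1,\xi_2)=\alpha^{(S)}(\xi_2)N_{i,p-1}^{r,\ell}(\xi_2)N_{1,p}^{r,\ell}(\xi_1).$$ The support of a function is the closure of the set where it is non-zero.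 *)

(* Defs.v *)
From mathcomp Require Import all_boot all_order all_algebra.
From mathcomp Require Import all_classical all_reals all_analysis.
Set Implicit Arguments.
Unset Strict Implicit.
Unset Printing Implicit Defensive.
Import Order.TTheory GRing.Theory Num.Theory.
Import numFieldNormedType.Exports.
Local Open Scope classical_set_scope.
Local Open Scope ring_scope.

(* Internal breakpoints are an increasing sequence s in ]0, 1[; the knot spans
   of [0, 1] are those of 0 :: s ++ [:: 1]. *)

Definition internal_breakpoints (R : realFieldType) (s : seq R) : bool :=
  sorted <%R (0 :: rcons s 1).

Fixpoint refine_from (R : realFieldType) (a : R) (s : seq R) : seq R :=
  match s with
  | [::] => [:: (a + 1) / 2]
  | b :: s' => [:: (a + b) / 2, b & refine_from b s']
  end.

Definition breakpoints (R : realFieldType) (tau : seq R) (l : nat) : seq R :=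
  iter l (refine_from 0) tau.

Definition open_knots (R : realFieldType) (p r : nat) (s : seq R) : seq R :=
  nseq p.+1 0 ++ flatten [seq nseq (p - r) t | t <- s] ++ nseq p.+1 1.

(* Cox-de Boor recursion of degree q on the knot vector t. Division by zero is
   zero, which is the usual convention for repeated knots. The last nonempty
   span is closed at the right end 1, so the B-splines are the usual ones on
   the whole of [0, 1]; their values outside [0, 1] are irrelevant. *)
Fixpoint cox_de_boor (R : realFieldType) (t : seq R) (q i : nat) (x : R) : R :=
  match q with
  | 0%N =>
      if (t`_i <= x < t`_i.+1) || [&& x == 1, t`_i < t`_i.+1 & t`_i.+1 == 1]
      then 1 else 0
  | q'.+1 =>
      (x - t`_i) / (t`_(i + q'.+1) - t`_i) * cox_de_boor t q' i x
      + (t`_(i + q'.+2) - x) / (t`_(i + q'.+2) - t`_i.+1)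
        * cox_de_boor t q' i.+1 x
  end.

Definition bspline (R : realFieldType) (p r : nat) (s : seq R) : nat -> R -> R :=
  cox_de_boor (open_knots p r s) p.

Definition spline_dim (R : realFieldType) (p r : nat) (s : seq R) : nat :=
  (p.+1 + size s * (p - r))%N.

Definition unit_square (R : realType) : set (R * R) :=
  `[0, 1]%classic `*` `[0, 1]%classic.

(* Derivative of a function on [0, 1], one-sided at the two end points. *)
Definition derive01 (R : realType) (V : normedModType R) (f : R -> V) (x : R)
    : V :=
  lim ((fun y => (y - x)^-1 *: (f y - f x)) @ within `[0, 1]%classic x^').

Definition pderive1 (R : realType) (f : R * R -> 'rV[R]_2) (x : R * R)
    : 'rV[R]_2 := derive01 (fun u => f (u, x.2)) x.1.

Definition pderive2 (R : realType) (f : R * R -> 'rV[R]_2) (x : R * R)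
    : 'rV[R]_2 := derive01 (fun v => f (x.1, v)) x.2.

Definition jacobian (R : realType) (f : R * R -> 'rV[R]_2) (x : R * R) : R :=
  \det (col_mx (pderive1 f x) (pderive2 f x) : 'M[R]_2).

Definition tensor_spline (R : realType) (p r : nat) (s : seq R)
    (f : R * R -> 'rV[R]_2) : Prop :=
  exists c : nat -> nat -> 'rV[R]_2, forall x, unit_square x ->
    f x = \sum_(i < spline_dim p r s) \sum_(j < spline_dim p r s)
            (bspline p r s i x.1 * bspline p r s j x.2) *: c i j.

Variant side := PatchL | PatchR.

Definition patch_dom (R : realType) (F : side -> R * R -> 'rV[R]_2)
    (S : side) : set 'rV[R]_2 := F S @` @unit_square R.

Definition Omega (R : realType) (F : side -> R * R -> 'rV[R]_2)
    : set 'rV[R]_2 := patch_dom F PatchL `|` patch_dom F PatchR.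

(* Bijectivity of F S onto its patch is injectivity on the unit square, since
   the patch is the image of the unit square. *)
Record two_patch_geometry (R : realType) (p r : nat) (tau : seq R)
    (F : side -> R * R -> 'rV[R]_2) : Prop := TwoPatchGeometry {
  geometry_spline : forall S, tensor_spline p r tau (F S);
  geometry_regular : forall S x, unit_square x -> jacobian (F S) x != 0;
  geometry_injective : forall S, set_inj (@unit_square R) (F S);
  geometry_edge : forall v, v \in `[0, 1] -> F PatchL (0, v) = F PatchR (0, v);
  geometry_interface :
    patch_dom F PatchL `&` patch_dom F PatchR
    = [set F PatchL (0, v) | v in `[0, 1]] }.

(* Size at most 2 is degree at most 1. *)
Record gluing_data (R : realType) (F : side -> R * R -> 'rV[R]_2)
    (alpha beta : side -> {poly R}) : Prop := GluingData {
  alpha_linear : forall S, (size (alpha S) <= 2)%N;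
  beta_linear : forall S, (size (beta S) <= 2)%N;
  alpha_coprime : coprimep (alpha PatchL) (alpha PatchR);
  alpha_opposite : forall v, v \in `[0, 1] ->
    (alpha PatchL).[v] * (alpha PatchR).[v] < 0;
  gluing_eq : forall v, v \in `[0, 1] ->
    (alpha PatchR).[v] *: pderive1 (F PatchL) (0, v)
    - (alpha PatchL).[v] *: pderive1 (F PatchR) (0, v)
    + (alpha PatchL * beta PatchR - alpha PatchR * beta PatchL).[v]
        *: pderive2 (F PatchL) (0, v) = 0 }.

Definition analysis_suitable_G1 (R : realType)
    (F : side -> R * R -> 'rV[R]_2) : Prop :=
  exists alpha beta, gluing_data F alpha beta.

Definition sqnorm01 (R : realType) (q : {poly R}) : R :=
  \int[lebesgue_measure]_(x in `[0, 1]%classic) (q.[x] ^+ 2).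

(* Regularity of F determines the admissible alpha up to a common nonzero
   factor, and such a factor leaves the admissible beta unchanged, so the two
   functionals are minimized simultaneously by one admissible choice. *)
Definition minimal_gluing_data (R : realType) (F : side -> R * R -> 'rV[R]_2)
    (alpha beta : side -> {poly R}) : Prop :=
  gluing_data F alpha beta /\
  forall alpha' beta', gluing_data F alpha' beta' ->
    sqnorm01 (alpha PatchL + 1) + sqnorm01 (alpha PatchR - 1)
      <= sqnorm01 (alpha' PatchL + 1) + sqnorm01 (alpha' PatchR - 1) /\
    sqnorm01 (beta PatchL) + sqnorm01 (beta PatchR)
      <= sqnorm01 (beta' PatchL) + sqnorm01 (beta' PatchR).

(* Functions on Omega are functions on the subtype of its points. The next
   predicate says that phi o F S = g S on the unit square for both S; as the
   patches cover Omega, it determines phi. *)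
Definition has_pullbacks (R : realType) (F : side -> R * R -> 'rV[R]_2)
    (g : side -> R -> R -> R) (phi : set_type (Omega F) -> R^o) : Prop :=
  forall S x (z : set_type (Omega F)), unit_square x -> \val z = F S x ->
    phi z = g S x.1 x.2.

Definition pull_interior (R : realType) (p r : nat) (s : seq R)
    (S' : side) (i j : nat) (S : side) (x1 x2 : R) : R :=
  if `[< S = S' >] then bspline p r s i x1 * bspline p r s j x2 else 0.

Definition pull_gamma0 (R : realType) (p r : nat) (s : seq R)
    (beta : side -> {poly R}) (i : nat) (S : side) (x1 x2 : R) : R :=
  bspline p r.+1 s i x2 * (bspline p r s 0 x1 + bspline p r s 1 x1)
  + (beta S).[x2] * derive01 (bspline p r.+1 s i : R -> R^o) x2
    * (s`_0 / p%:R) * bspline p r s 1 x1.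

Definition pull_gamma1 (R : realType) (p r : nat) (s : seq R)
    (alpha : side -> {poly R}) (i : nat) (S : side) (x1 x2 : R) : R :=
  (alpha S).[x2] * bspline p.-1 r s i x2 * bspline p r s 1 x1.

Definition Phi_interior (R : realType) (p r : nat) (s : seq R)
    (F : side -> R * R -> 'rV[R]_2) (S' : side)
    : set (set_type (Omega F) -> R^o) :=
  [set phi | exists i j : nat,
     [/\ (2 <= i < spline_dim p r s)%N, (j < spline_dim p r s)%N &
         has_pullbacks (pull_interior p r s S' i j) phi]].

Definition Phi_gamma0 (R : realType) (p r : nat) (s : seq R)
    (F : side -> R * R -> 'rV[R]_2) (beta : side -> {poly R})
    : set (set_type (Omega F) -> R^o) :=
  [set phi | exists2 i : nat, (i < spline_dim p r.+1 s)%N &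
     has_pullbacks (pull_gamma0 p r s beta i) phi].

Definition Phi_gamma1 (R : realType) (p r : nat) (s : seq R)
    (F : side -> R * R -> 'rV[R]_2) (alpha : side -> {poly R})
    : set (set_type (Omega F) -> R^o) :=
  [set phi | exists2 i : nat, (i < spline_dim p.-1 r s)%N &
     has_pullbacks (pull_gamma1 p r s alpha i) phi].

Definition Phi (R : realType) (p r : nat) (tau : seq R)
    (F : side -> R * R -> 'rV[R]_2) (alpha beta : side -> {poly R}) (l : nat)
    : set (set_type (Omega F) -> R^o) :=
  let s := breakpoints tau l in
  Phi_interior p r s PatchL `|` Phi_interior p r s PatchR
  `|` Phi_gamma0 p r s beta `|` Phi_gamma1 p r s alpha.

(* The closure is taken in the plane; Omega is compact, so this is also the
   closure in Omega. *)
Definition supp (R : realType) (F : side -> R * R -> 'rV[R]_2)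
    (phi : set_type (Omega F) -> R^o) : set 'rV[R]_2 :=
  closure [set \val z | z in [set z | phi z != 0]].

Definition hier_basis (R : realType) (p r : nat) (tau : seq R)
    (F : side -> R * R -> 'rV[R]_2) (alpha beta : side -> {poly R})
    (N : nat) (Om : nat -> set 'rV[R]_2) : set (set_type (Omega F) -> R^o) :=
  [set phi | exists l : nat,
     [/\ (l <= N - 1)%N, Phi p r tau alpha beta l phi,
         supp phi `&` Om 0%N `<=` Om l &
         ~ supp phi `&` Om 0%N `<=` Om l.+1]].

Definition lin_indep (K : nzRingType) (V : lmodType K) (A : set V) : Prop :=
  forall (s : seq V) (c : V -> K), uniq s -> (forall v, v \in s -> A v) ->
    \sum_(v <- s) c v *: v = 0 -> forall v, v \in s -> c v = 0.

Definition lin_span (K : nzRingType) (V : lmodType K) (A : set V) : set V :=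
  [set w | exists (s : seq V) (c : V -> K),
     (forall v, v \in s -> A v) /\ w = \sum_(v <- s) c v *: v].

Definition is_basis (K : nzRingType) (V : lmodType K) (A W : set V) : Prop :=
  lin_indep A /\ lin_span A = W.

Definition hier_space (R : realType) (p r : nat) (tau : seq R)
    (F : side -> R * R -> 'rV[R]_2) (alpha beta : side -> {poly R})
    (N : nat) (Om : nat -> set 'rV[R]_2) : set (set_type (Omega F) -> R^o) :=
  lin_span (hier_basis p r tau alpha beta N Om).

(* Main.v *)
(* At a point x of the unit square look at germs along the quadrant of the knot
   span chosen by the Cox-de Boor recursion (to the right of each coordinate, to
   the left at 1). Marsden's identity shows that the B-splines which do not
   vanish on that germ are linearly independent on it. This gives local
   independence of each level: since N_0 and N_1 have the same support [0, tau_1]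
   (the knot tau_1 is at least double), the coefficient of N_0 in xi_1 isolates
   the functions of Gamma_0, and after that the coefficient of N_1 isolates those
   of Gamma_1, because alpha does not vanish. Independence of the hierarchy
   follows by induction on the level: off the closed set Omega^{l+1} only the
   levels up to l are visible, and every selected function of level l is nonzero
   somewhere there. *)
Require Import Defs.
From mathcomp Require Import all_boot all_order all_algebra.
From mathcomp Require Import all_classical all_reals all_analysis.
From mathcomp Require Import zify ring lra.
Set Implicit Arguments.
Unset Strict Implicit.
Unset Printing Implicit Defensive.
Import Order.TTheory GRing.Theory Num.Theory.
Import numFieldNormedType.Exports.
Local Open Scope classical_set_scope.
Local Open Scope ring_scope.

(** * Marsden's identity and independence of B-splines on one knot span *)

(** Membership of [y] in the span [j] is stated through the degree-zero values, so the closed right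
    end 1 needs no separate case in the recursion. *)
Definition at_span {R : realFieldType} (t : seq R) (j : nat) (y : R) :=
  forall i, cox_de_boor t 0 i y = (i == j)%:R.

Lemma cox_de_boorS (R : realFieldType) (t : seq R) (q i : nat) (y : R) :
  cox_de_boor t q.+1 i y
  = (y - t`_i) / (t`_(i + q.+1) - t`_i) * cox_de_boor t q i y
    + (t`_(i + q.+2) - y) / (t`_(i + q.+2) - t`_i.+1) * cox_de_boor t q i.+1 y.
Proof. by []. Qed.

Arguments cox_de_boor : simpl never.

Lemma cox_de_boor_supp (R : realFieldType) (t : seq R) (j q i : nat) (y : R) :
  at_span t j y -> ~~ (i <= j <= i + q)%N -> cox_de_boor t q i y = 0.
Proof.
move=> hy; elim: q i => [|q IH] i h.
  by rewrite hy; case: eqP h => // ->; rewrite leqnn addn0 leqnn.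
by rewrite cox_de_boorS !IH ?mulr0 ?addr0 //; lia.
Qed.

Lemma sorted_nth_le (R : realFieldType) (t : seq R) (a b : nat) :
  sorted <=%R t -> (a <= b)%N -> (b < size t)%N -> t`_a <= t`_b.
Proof.
move=> st ab bs; apply: (sorted_leq_nth le_trans le_refl) => //.
by rewrite inE (leq_ltn_trans ab).
Qed.

(** In Marsden's identity [v] and [u] are the first and last knots of the support of a B-spline; the
    two weights which the recursion gives to it merge these knots into [y]. *)
Lemma affine_comb_XsubC (R : fieldType) (u v y : R) : u - v != 0 ->
  ((y - v) / (u - v)) *: ('X - u%:P) + ((u - y) / (u - v)) *: ('X - v%:P)
  = 'X - y%:P.
Proof.
move=> uv; rewrite !scalerBr addrACA -scalerDl -mulrDl -opprD.
have -> : y - v + (u - y) = u - v by ring.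
rewrite divff // scale1r -!mul_polyC -!polyCM -polyCD.
by congr (_ - _%:P); field.
Qed.

(** An identity of polynomials in ['X] with [y] fixed, by induction on the degree: after expanding
    the recursion, the two terms containing the same lower-degree B-spline differ in one linear
    factor only. *)
Lemma marsden (R : realFieldType) (t : seq R) (j q : nat) (y : R) :
  sorted <=%R t -> t`_j < t`_j.+1 -> at_span t j y ->
  (q <= j)%N -> (j + q < size t)%N ->
  ('X - y%:P) ^+ q
  = \sum_(i < j.+1)
      cox_de_boor t q i y *: \prod_(m < q) ('X - (t`_(i + m.+1))%:P).
Proof.
move=> st tj hy; elim: q => [|q IH] qj jq.
  rewrite expr0 (bigD1 ord_max) //= (hy j) eqxx scale1r big_ord0 big1 ?addr0 //.
  move=> i; rewrite -val_eqE /= => /negbTE ij.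
  by rewrite (hy i) ij scale0r.
rewrite exprS IH; [|lia|lia].
under [RHS]eq_bigr do rewrite cox_de_boorS scalerDl.
rewrite big_split /= [in LHS]big_ord_recl [X in _ = X + _]big_ord_recl.
rewrite [X in _ = _ + X]big_ord_recr /=.
(* Both extreme terms vanish because [q < j]; what remains of the two sums is indexed by the same
   B-splines [i.+1] and can be compared term by term. *)
rewrite (@cox_de_boor_supp _ t j q 0) //; last by lia.
rewrite (@cox_de_boor_supp _ t j q j.+1) //; last by lia.
rewrite !mulr0 !scale0r add0r addr0 add0r -big_split /= mulr_sumr.
apply: eq_bigr => i _; rewrite /bump /= add1n.
have [act|nact] := boolP (i.+1 <= j <= i.+1 + q)%N; last first.
  by rewrite (cox_de_boor_supp hy nact) !mulr0 !scale0r mulr0 addr0.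
set d := t`_(i.+1 + q.+1) - t`_i.+1.
(* The support of an active B-spline contains the nonempty span [j], so repeated knots cannot make
   this denominator zero. *)
have d0 : d != 0.
  rewrite subr_eq0 gt_eqF // (le_lt_trans _ (lt_le_trans tj _)) //;
    by apply: sorted_nth_le => //; lia.
rewrite [in X in _ = X + _]big_ord_recr [in X in _ = _ + X]big_ord_recl /=.
rewrite addn1 -[(i + q.+2)%N]addSnnS.
under [in X in _ = _ + X]eq_bigr do rewrite /bump /= add1n -addSnnS.
(* [P] is the product over the [q] interior knots shared by the neighbours [i] and [i.+1]. *)
set P := \prod_(m < q) _; set B := cox_de_boor t q i.+1 y.
by rewrite -(affine_comb_XsubC y d0) -/d mulrDl -!scalerAl -!scalerAr !scalerA
           [P * _]mulrC.
Qed.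

Lemma big_window (V : nmodType) (n j q : nat) (f : nat -> V) :
  (forall i, ~~ (i <= j <= i + q)%N -> f i = 0) -> (q <= j < n)%N ->
  \sum_(i < n) f i = \sum_(i < q.+1) f (j - q + i)%N.
Proof.
move=> f0 /andP[qj jn].
rewrite -(big_mkord xpredT f) (big_cat_nat (n := (j - q)%N)) //=; last by lia.
rewrite (big_cat_nat (m := (j - q)%N) (n := j.+1)) //=; last by lia.
rewrite big_nat big1 ?add0r; last by move=> i hi; apply: f0; lia.
rewrite [X in _ + X]big_nat [X in _ + X]big1 ?addr0; last first.
  by move=> i hi; apply: f0; lia.
rewrite -{1}[(j - q)%N]add0n big_addn big_mkord.
have -> : (j.+1 - (j - q))%N = q.+1 by lia.
by apply: eq_bigr => i _; rewrite addnC.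
Qed.

(* The powers of the [X - y m] are independent: a relation between their
   coefficients is a polynomial of degree at most [q] with the [q.+1] roots
   [y m]. *)
Lemma coef_XsubC_exp_unitmx (R : realFieldType) (q : nat) (y : nat -> R) :
  injective y ->
  \matrix_(m < q.+1, l < q.+1) (('X - (y m)%:P) ^+ q)`_l \in unitmx.
Proof.
move=> yi; set W := \matrix_(m, l) _.
rewrite -unitmx_tr -row_free_unit; apply: inj_row_free => v vW.
(* The coefficient of ['X^l] in [('X - a%:P) ^+ q] is a binomial times a power of [- a], so [P] is
   the relation [v] read as a polynomial in [a]. *)
pose P := \sum_(l < q.+1) (v 0 l *+ 'C(q, l)) *: (- 'X) ^+ (q - l) : {poly R}.
have coefE (a : R) (l : 'I_q.+1) :
    (('X - a%:P) ^+ q)`_l = (- a) ^+ (q - l) *+ 'C(q, l).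
  rewrite addrC -polyCN exprDn coef_sum (bigD1 l) //= -polyC_exp coefMn coefCM.
  rewrite coefXn eqxx mulr1 big1 ?addr0 // => i il.
  by rewrite -polyC_exp coefMn coefCM coefXn val_eqE eq_sym (negbTE il)
             mulr0 mul0rn.
have P0 : P = 0.
  apply: (@roots_geq_poly_eq0 _ P (map y (iota 0 q.+1))).
  - apply/allP => x /mapP[m]; rewrite mem_iota add0n => /andP[_ mq] ->.
    have /rowP/(_ (Ordinal mq)) := vW; rewrite !mxE /root => <-.
    rewrite horner_sum; apply/eqP; apply: eq_bigr => l _.
    rewrite !mxE coefE hornerZ horner_exp hornerN hornerX /=.
    by rewrite mulrnAl mulrnAr.
  - by rewrite map_inj_uniq ?iota_uniq.
  - rewrite size_map size_iota; apply: leq_trans (size_sum _ _ _) _.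
    apply/bigmax_leqP => l _; apply: leq_trans (size_scale_leq _ _) _.
    by rewrite exprNn size_Msign size_polyXn ltnS leq_subr.
apply/rowP => l; rewrite mxE.
have := congr1 (fun p : {poly R} => p`_(q - l)%N) P0.
rewrite coef0 coef_sum (bigD1 l) //= big1 ?addr0; last first.
  move=> i il; rewrite coefZ exprNn -signr_odd; case: odd;
    rewrite ?mulN1r ?mul1r ?coefN coefXn; 
    (have -> : (q - l == q - i)%N = false
      by apply/eqP => ?; move/eqP: il; apply; apply: val_inj => /=;
        have := ltn_ord i; have := ltn_ord l; lia);
    by rewrite ?oppr0 mulr0.
rewrite coefZ exprNn -signr_odd => /eqP; rewrite mulf_eq0 => /orP[|].
  by rewrite mulrn_eq0 eqn0Ngt bin_gt0 -ltnS ltn_ord /= => /eqP.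
by case: odd; rewrite ?mulN1r ?mul1r ?coefN coefXn eqxx ?oppr_eq0 oner_eq0.
Qed.

(** By Marsden's identity the collocation matrix [B] at [q.+1] distinct points, times the matrix
    [Psi] of knot products, is the invertible matrix of the powers; hence [B] is invertible and
    kills no nonzero coefficient vector. *)
Lemma cox_de_boor_indep (R : realFieldType) (t : seq R) (j q n : nat)
    (y : nat -> R) (c : nat -> R) :
  sorted <=%R t -> t`_j < t`_j.+1 -> (q <= j < n)%N -> (j + q < size t)%N ->
  injective y -> (forall m, at_span t j (y m)) ->
  (forall m, \sum_(i < n) c i * cox_de_boor t q i (y m) = 0) ->
  forall i, (i <= j <= i + q)%N -> c i = 0.
Proof.
move=> st tj /andP[qj jn] jq yi hy hc i hi.
pose B : 'M[R]_q.+1 := \matrix_(m, k) cox_de_boor t q (j - q + k) (y m).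
pose Psi : 'M[R]_q.+1 :=
  \matrix_(k, l) (\prod_(m < q) ('X - (t`_(j - q + k + m.+1))%:P))`_l.
have BPsi : B *m Psi
    = \matrix_(m < q.+1, l < q.+1) (('X - (y m)%:P) ^+ q)`_l.
  apply/matrixP => m l; rewrite !mxE (marsden st tj (hy m) qj jq).
  rewrite (@big_window _ j.+1 j q (fun i => cox_de_boor t q i (y m) *:
    \prod_(m0 < q) ('X - (t`_(i + m0.+1))%:P))) ?qj ?ltnSn //; last first.
    by move=> i0 hi0; rewrite (cox_de_boor_supp (hy m) hi0) scale0r.
  by rewrite coef_sum; apply: eq_bigr => k _; rewrite !mxE coefZ.
have uB : B \in unitmx.
  by have := coef_XsubC_exp_unitmx q yi; rewrite -BPsi unitmx_mul => /andP[].
pose C : 'cV[R]_q.+1 := \col_k c (j - q + k)%N.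
have BC : B *m C = 0.
  apply/colP => m; rewrite !mxE -[RHS](hc m).
  rewrite (@big_window _ n j q (fun i => c i * cox_de_boor t q i (y m)))
    ?qj ?jn //; last first.
    by move=> i0 hi0; rewrite (cox_de_boor_supp (hy m) hi0) mulr0.
  by apply: eq_bigr => k _; rewrite !mxE mulrC.
have C0 : C = 0 by rewrite -(mulKmx uB C) BC mulmx0.
have ki : (i - (j - q) < q.+1)%N by lia.
by have /colP/(_ (Ordinal ki)) := C0; rewrite !mxE /= subnKC //; lia.
Qed.

(** * Breakpoints, open knot vectors and their spans *)

Lemma refine_from_path (R : realFieldType) (a : R) (s : seq R) :
  path <%R a (rcons s 1) -> path <%R a (rcons (refine_from a s) 1).
Proof.
elim: s a => [|b s IH] a /=.
  by rewrite andbT => a1; rewrite !midf_lt.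
by move=> /andP[ab sb]; rewrite !midf_lt //= IH.
Qed.

Lemma breakpoints_internal (R : realFieldType) (tau : seq R) (l : nat) :
  internal_breakpoints tau -> internal_breakpoints (breakpoints tau l).
Proof. by move=> tau1; elim: l => //= l; apply: refine_from_path. Qed.

Lemma breakpoints_gt0 (R : realFieldType) (tau : seq R) (l : nat) :
  (0 < size tau)%N -> (0 < size (breakpoints tau l))%N.
Proof.
by case: l => // l _; rewrite /breakpoints iterS; case: (iter _ _ _).
Qed.

Lemma size_open_knots (R : realFieldType) (p r : nat) (s : seq R) :
  size (open_knots p r s) = (spline_dim p r s + p.+1)%N.
Proof.
rewrite /open_knots /spline_dim !size_cat !size_nseq addnA; congr (_ + _ + _)%N.
by elim: s => //= a s IH; rewrite size_cat size_nseq IH mulSn.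
Qed.

Lemma sorted_open_knots (R : realFieldType) (p r : nat) (s : seq R) :
  internal_breakpoints s -> sorted <=%R (open_knots p r s).
Proof.
have nseq_path (a b : R) m w : a <= b -> path <=%R b w ->
    path <=%R a (nseq m b ++ w).
  move=> ab bw; have bbw : path <=%R b (nseq m b ++ w).
    by elim: m => //= m ->; rewrite lexx.
  case: m bbw => [|m /= /andP[_ ->]]; last by rewrite ab.
  by case: w bw => //= c w /andP[bc ->] _; rewrite (le_trans ab).
have inner (a : R) : path <%R a (rcons s 1) ->
    path <=%R a (flatten [seq nseq (p - r) t | t <- s] ++ nseq p.+1 1).
  elim: s a => [|b s IH] a /=.
    rewrite andbT => /ltW a1; rewrite a1 /=.
    by have := nseq_path 1 1 p [::] (lexx 1) isT; rewrite cats0.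
  by move=> /andP[/ltW ab sb]; rewrite -catA; apply: nseq_path => //; apply: IH.
by move=> /inner s0; apply: nseq_path.
Qed.

Lemma open_knots0 (R : realFieldType) (p r : nat) (s : seq R) (i : nat) :
  (i <= p)%N -> (open_knots p r s)`_i = 0.
Proof.
move=> ip; rewrite /open_knots nth_cat size_nseq ltnS ip.
by rewrite (@nth_nseq R) if_same.
Qed.

Lemma open_knots1 (R : realFieldType) (p r : nat) (s : seq R) (i : nat) :
  (spline_dim p r s <= i <= spline_dim p r s + p)%N ->
  (open_knots p r s)`_i = 1.
Proof.
move=> hi; have := size_open_knots p r s.
rewrite /open_knots catA size_cat size_nseq => /addIn sz.
rewrite nth_cat sz ltnNge (andP hi).1 (@nth_nseq R).
by have -> : (i - spline_dim p r s < p.+1)%N by lia.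
Qed.

Lemma open_knots_first (R : realFieldType) (p r : nat) (s : seq R) (m : nat) :
  (0 < size s)%N -> (m < p - r)%N -> (open_knots p r s)`_(p.+1 + m) = s`_0.
Proof.
move=> s0 mp; rewrite /open_knots nth_cat size_nseq ltnNge leq_addr /= addKn.
by case: s s0 => //= a s _; rewrite -catA nth_cat size_nseq mp (@nth_nseq R) mp.
Qed.

Lemma discrete_ivt (P : pred nat) (a b : nat) : (a < b)%N -> P a -> ~~ P b ->
  exists j, [/\ (a <= j < b)%N, P j & ~~ P j.+1].
Proof.
move=> + Pa; elim: b => // b IH; rewrite ltnS => ab Pb.
have [Pb'|Pb'] := boolP (P b); first by exists b; split=> //; rewrite ab /=.
have /IH/(_ Pb') [j [/andP[aj jb] Pj Pj1]] : (a < b)%N.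
  by rewrite ltn_neqAle ab andbT; apply: contraNneq Pb' => <-.
by exists j; split=> //; rewrite aj ltnS ltnW.
Qed.

Lemma at_span_lt1 (R : realFieldType) (t : seq R) (j : nat) (y : R) :
  sorted <=%R t -> (j.+1 < size t)%N -> 0 <= y < 1 -> t`_j <= y < t`_j.+1 ->
  at_span t j y.
Proof.
move=> st js /andP[y0 y1] /andP[tj tj1] i.
rewrite /cox_de_boor lt_eqF //= orbF.
have [->|ij] := eqVneq i j; first by rewrite tj tj1.
case: ifP => // /andP[ti ti1]; exfalso.
have [ij'|ji] : (i < j \/ j < i)%N by lia.
  have : t`_i.+1 <= t`_j by apply: sorted_nth_le => //; lia.
  by rewrite leNgt (le_lt_trans tj).
have [it|it] := ltnP i (size t).
  have : t`_j.+1 <= t`_i by apply: sorted_nth_le.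
  by rewrite leNgt (le_lt_trans ti).
(* Beyond the end of [t] the knots read as the default 0, which cannot exceed [y]. *)
by move: ti1; rewrite nth_default ?ltNge ?y0 // leqW.
Qed.

Lemma at_span_1 (R : realFieldType) (t : seq R) (j : nat) :
  sorted <=%R t -> (j.+1 < size t)%N -> (forall i, t`_i <= 1) ->
  t`_j < 1 -> t`_j.+1 = 1 -> at_span t j 1.
Proof.
move=> st js t1 tj tj1 i.
rewrite /cox_de_boor (ltNge 1) (t1 i.+1) /= andbF eqxx /=.
have [->|ij] := eqVneq i j; first by rewrite tj1 tj eqxx.
case: ifP => // /andP[+ /eqP ti1]; rewrite ti1 => ti; exfalso.
have [ij'|ji] : (i < j \/ j < i)%N by lia.
  have : t`_i.+1 <= t`_j by apply: sorted_nth_le => //; lia.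
  by rewrite ti1 leNgt tj.
have [it|it] := ltnP i (size t).
  have : t`_j.+1 <= t`_i by apply: sorted_nth_le.
  by rewrite tj1 leNgt ti.
have : (0 : R) = 1 by rewrite -ti1 nth_default // leqW.
by move/eqP; rewrite eq_sym oner_eq0.
Qed.

Lemma open_knots_le1 (R : realFieldType) (p r : nat) (s : seq R) (i : nat) :
  internal_breakpoints s -> (open_knots p r s)`_i <= 1.
Proof.
move=> s1; have [it|it] := ltnP i (size (open_knots p r s)); last first.
  by rewrite nth_default.
rewrite -(@open_knots1 _ p r s (spline_dim p r s + p)); last first.
  by rewrite leq_addr leqnn.
apply: sorted_nth_le; first exact: sorted_open_knots.
all: by move: it; rewrite size_open_knots; lia.
Qed.

(* The span to the right of [x], or the last one if [x = 1]; in both cases it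
   carries the same polynomial piece as the value at [x]. *)
Lemma open_knots_span (R : realFieldType) (p r : nat) (s : seq R) (x : R) :
  internal_breakpoints s -> 0 <= x <= 1 ->
  exists j, let t := open_knots p r s in
   [/\ (p <= j < spline_dim p r s)%N, t`_j < t`_j.+1, at_span t j x,
       x < 1 -> t`_j <= x < t`_j.+1 & x = 1 -> t`_j < 1 <= t`_j.+1].
Proof.
move=> s1 /andP[x0 x1]; set t := open_knots p r s.
have st := sorted_open_knots p r s1.
have pn : (p < spline_dim p r s)%N by rewrite /spline_dim; lia.
have tn : t`_(spline_dim p r s) = 1 by apply: open_knots1; lia.
have sz := size_open_knots p r s.
move: x1; rewrite le_eqVlt => /predU1P[->|x1].
  have [||j [hj tj]] := @discrete_ivt (fun i => t`_i < 1) _ _ pn.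
  - by rewrite open_knots0.
  - by rewrite tn ltxx.
  rewrite -leNgt => tj1; have tj1' : t`_j.+1 = 1.
    by apply/le_anti; rewrite tj1 andbT; apply: open_knots_le1.
  exists j; split=> //; rewrite ?tj1' ?lexx ?andbT ?ltxx //.
  apply: at_span_1 => //; first by move: (andP hj).2; rewrite sz; lia.
  by move=> i; apply: open_knots_le1.
have [||j [hj tj]] := @discrete_ivt (fun i => t`_i <= x) _ _ pn.
- by rewrite open_knots0.
- by rewrite tn -ltNge.
rewrite -ltNge => tj1.
exists j; split=> //; first exact: le_lt_trans tj tj1.
- apply: at_span_lt1; rewrite ?x0 ?x1 ?tj ?tj1 //.
  by move: (andP hj).2; rewrite sz; lia.
- by rewrite tj tj1.
- by move=> xe; rewrite xe ltxx in x1.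
Qed.

(** * One-sided germs and local independence of B-splines *)

(* One-sided germs: from the left at the end point 1, from the right elsewhere,
   matching the half-open spans of the Cox-de Boor recursion. Along them every
   B-spline is continuous, whatever the knot multiplicities. *)
Definition germ {R : realType} (x : R) : set_system R :=
  if x == 1 then x^'- else x^'+.

Global Instance germ_proper (R : realType) (x : R) : ProperFilter (germ x).
Proof.
rewrite /germ; case: ifP => _;
  [exact: at_left_proper_filter|exact: at_right_proper_filter].
Qed.

(** Both kinds of germ are replaced by an open interval inside [[0, 1]], with [x] as its left end,
    or its right end if [x = 1]. *)
Lemma germ_interval (R : realType) (x : R) (P : R -> Prop) : 0 <= x <= 1 ->
  (\forall y \near germ x, P y) -> exists a b : R,
  [/\ 0 <= a < b, b <= 1, forall y, a < y < b -> P y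
    & \forall y \near germ x, a < y < b].
Proof.
move=> /andP[x0 x1]; rewrite /germ; case: eqP => [->|/eqP x1'].
  rewrite !near_withinE => -[e /= e0 he].
  exists (Num.max 0 (1 - e)), 1; split=> //.
  - by rewrite le_max lexx gt_max ltr01 /=; lra.
  - move=> y; rewrite gt_max => /andP[/andP[y0 ye] y1]; apply: he => //=.
    by rewrite ger0_norm; lra.
  - exists (Num.min 1 e); first by rewrite /= lt_min ltr01.
    move=> y /=; rewrite lt_min => /andP[d1 de] y1; rewrite gt_max y1 andbT.
    by move: d1 de; rewrite ger0_norm; last lra;
      move=> *; apply/andP; split; lra.
have {x1'}x1 : x < 1 by rewrite lt_neqAle x1' x1.
rewrite !near_withinE => -[e /= e0 he].
exists x, (Num.min 1 (x + e)); split=> //.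
- by rewrite x0 lt_min x1; lra.
- by rewrite ge_min lexx.
- move=> y; rewrite lt_min => /andP[xy /andP[y1 ye]]; apply: he => //=.
  by rewrite ltr0_norm; lra.
- exists (Num.min (1 - x) e); first by rewrite /= lt_min e0 subr_gt0 x1.
  move=> y /=; rewrite lt_min => /andP[d1 de] xy; rewrite xy lt_min /=.
  by move: d1 de; rewrite ltr0_norm; last lra;
    move=> *; apply/andP; split; lra.
Qed.

Lemma germ01 (R : realType) (x : R) : 0 <= x <= 1 ->
  \forall y \near germ x, 0 < y < 1.
Proof.
move=> x01; have [a [b [/andP[a0 ab] b1 _ ?]]] :=
  germ_interval x01 (filterT : \forall y \near germ x, True).
near=> y; have /andP[ay yb] : a < y < b by near: y.
by rewrite (le_lt_trans a0 ay) (lt_le_trans yb b1).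
Unshelve. all: by end_near. Qed.

Lemma germ_inj_seq (R : realType) (x : R) (P : R -> Prop) : 0 <= x <= 1 ->
  (\forall y \near germ x, P y) ->
  exists y : nat -> R, injective y /\ forall m, P (y m).
Proof.
move=> x01 /(germ_interval x01)[a [b [/andP[_ ab] _ hP _]]].
have ba : b - a != 0 by rewrite subr_eq0 gt_eqF.
(* The denominators start at 2, which keeps every sample strictly below [b]. *)
exists (fun m => a + (b - a) / m.+2%:R); split.
  by move=> m n /addrI/(mulfI ba)/invr_inj/eqP; rewrite eqr_nat => /eqP[].
move=> m; apply: hP; rewrite ltrDl divr_gt0 ?subr_gt0 ?ltr0n //=.
by rewrite -ltrBrDl ltr_pdivrMr ?ltr0n // ltr_pMr ?subr_gt0 // ltr1n.
Qed.

(** Needed for derivatives: [derive01_eq0] at a nearby point [y] requires vanishing on the germ of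
    [y], not only at [y]. *)
Lemma near_germ_germ (R : realType) (x : R) (P : R -> Prop) : 0 <= x <= 1 ->
  (\forall y \near germ x, P y) ->
  \forall y \near germ x, \forall z \near germ y, P z.
Proof.
move=> x01 /(germ_interval x01)[a [b [/andP[_ ab] b1 hP hab]]].
near=> y; have /andP[ay yb] : a < y < b by near: y.
rewrite /germ lt_eqF; last exact: lt_le_trans b1.
have yz : \forall z \near y^'+, y < z by exact: nbhs_right_gt.
have zb : \forall z \near y^'+, z < b by exact: nbhs_right_lt.
near=> z; apply: hP; apply/andP; split; last by near: z.
apply: (lt_trans ay).
by near: z.
Unshelve. all: by end_near. Qed.

Lemma germ_nbhs (R : realType) (x : R) : germ x --> x.
Proof. by rewrite /germ; case: ifP => _; apply: cvg_within. Qed.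

(** The germ refines the filter used by [derive01], so a limit of difference quotients can be
    computed along the germ. *)
Lemma germ_within01 (R : realType) (x : R) : 0 <= x <= 1 ->
  germ x `=>` within `[0, 1]%classic x^'.
Proof.
move=> x01 P; rewrite /within /= => hP.
have hP' : \forall y \near germ x, y != x -> `[0, 1]%classic y -> P y.
  exact: (germ_nbhs hP).
have hx : \forall y \near germ x, y != x.
  rewrite /germ; case: ifP => _; near=> y.
    by rewrite lt_eqF //; near: y; exact: nbhs_left_lt.
  by rewrite gt_eqF //; near: y; exact: nbhs_right_gt.
have h01 := germ01 x01.
near=> y; have /andP[y0 y1] : 0 < y < 1 by near: y.
apply: (near hP' y) => //; first by near: y.
by rewrite /= in_itv /= !ltW.
Unshelve. all: by end_near. Qed.

(* If the difference quotients diverge then [lim] takes its default value 0. *)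
Lemma derive01_eq0 (R : realType) (f : R -> R^o) (x : R) : 0 <= x <= 1 ->
  f x = 0 -> (\forall y \near germ x, f y = 0) -> derive01 f x = 0.
Proof.
move=> x01 fx fy; rewrite /derive01; set q := (q in q @ _).
have [cq|/dvgP -> //] := pselect (cvg (q @ within `[0, 1]%classic x^')).
have q0 : q @ germ x --> (0 : R^o).
  apply: cvg_near_cst; near=> y; rewrite /q fx.
  by have -> : f y = 0 by [near: y]; rewrite subrr scaler0.
have ql : q @ germ x --> lim (q @ within `[0, 1]%classic x^').
  exact: cvg_trans (cvg_app q (germ_within01 x01)) cq.
exact: (cvg_unique _ ql q0).
Unshelve. all: by end_near. Qed.

Lemma germ_span (R : realType) (x u v : R) : 0 <= x <= 1 ->
  (x < 1 -> u <= x < v) -> (x = 1 -> u < 1 <= v) ->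
  \forall y \near germ x, u <= y < v.
Proof.
move=> x01 h1 h2; rewrite /germ; have [x1|x1] := eqVneq x 1.
  have /andP[u1 v1] := h2 x1; rewrite x1.
  have hu := nbhs_left_gt u1; have hl := nbhs_left_lt (1 : R).
  near=> y; apply/andP; split; first by apply: ltW; near: y.
  by apply: lt_le_trans v1; near: y.
have /h1/andP[ux xv] : x < 1 by rewrite lt_neqAle x1; case/andP: x01 => _ ->.
have hv := nbhs_right_lt xv; have hx := nbhs_right_gt x.
near=> y; apply/andP; split; last by near: y.
by apply: (le_trans ux); apply: ltW; near: y.
Unshelve. all: by end_near. Qed.

Lemma bspline_germ (R : realType) (p r : nat) (s : seq R) (x : R) :
  internal_breakpoints s -> 0 <= x <= 1 ->
  exists j, let t := open_knots p r s in
   [/\ (p <= j < spline_dim p r s)%N, t`_j < t`_j.+1, at_span t j x &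
       \forall y \near germ x, at_span t j y].
Proof.
move=> s1 x01; have [j [hj tj hx h1 h2]] := @open_knots_span _ p r s x s1 x01.
exists j; split=> //.
have hspan := germ_span x01 h1 h2; have h01 := germ01 x01.
near=> y; apply: at_span_lt1; first exact: sorted_open_knots.
- by move: (andP hj).2; rewrite size_open_knots; lia.
- have /andP[y0 ->] : 0 < y < 1 by near: y.
  by rewrite ltW.
- by near: y.
Unshelve. all: by end_near. Qed.

(** In degree zero the values are constant on the germ, since [x] and its germ share one span; the
    recursion then preserves convergence. *)
Lemma bspline_cvg (R : realType) (p r : nat) (s : seq R) (i : nat) (x : R) :
  internal_breakpoints s -> 0 <= x <= 1 ->
  bspline p r s i y @[y --> germ x] --> bspline p r s i x.
Proof.
move=> s1 x01; have [j [_ _ hx hy]] := @bspline_germ _ p r s x s1 x01.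
rewrite /bspline; move: (open_knots p r s) hx hy => t hx hy.
elim: p i => [|q IH] i.
  apply: cvg_near_cst; near=> y.
  have hyy : at_span t j y by near: y.
  by rewrite hyy hx.
under eq_fun do rewrite cox_de_boorS.
rewrite cox_de_boorS.
have gx := @germ_nbhs _ x.
apply: cvgD; apply: cvgM => //; apply: cvgMl; apply: cvgB => //; exact: cvg_cst.
Unshelve. all: by end_near. Qed.

Lemma bspline_locally_indep (R : realType) (p r : nat) (s : seq R) (x : R) :
  internal_breakpoints s -> 0 <= x <= 1 ->
  exists j, let t := open_knots p r s in
   [/\ (p <= j < spline_dim p r s)%N, t`_j < t`_j.+1,
       forall i, ~~ (i <= j <= i + p)%N -> bspline p r s i x = 0 /\
         \forall y \near germ x, bspline p r s i y = 0 &
       forall c : 'I_(spline_dim p r s) -> R,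
         (\forall y \near germ x, \sum_i c i * bspline p r s i y = 0) ->
         forall i : 'I_(spline_dim p r s), (i <= j <= i + p)%N -> c i = 0].
Proof.
move=> s1 x01; have [j [hj tj hx hy]] := @bspline_germ _ p r s x s1 x01.
exists j; split=> // [i hi|c hc i hi].
  split; first exact: cox_de_boor_supp hx hi.
  by apply: filterS hy => y hy; apply: cox_de_boor_supp hy hi.
have [y [yi yP]] := germ_inj_seq x01 (filterI hy hc).
(* Extends the coefficients by 0 from ordinals to all naturals. *)
pose c' m := oapp c 0 (insub m).
have c'E (m : 'I_(spline_dim p r s)) : c' m = c m by rewrite /c' valK.
rewrite -c'E; apply: (@cox_de_boor_indep _ (open_knots p r s) j p
  (spline_dim p r s) y c' _ tj hj) => //.
- exact: sorted_open_knots.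
- by move: (andP hj).2; rewrite size_open_knots; lia.
- by move=> m; case: (yP m).
move=> m; case: (yP m) => _ hm; rewrite -[RHS]hm.
by apply: eq_bigr => l _; rewrite c'E.
Qed.

(** * Local independence of the functions of one level *)

Section LocalIndependence.
Context (R : realType) (p r : nat) (s : seq R) (alpha beta : side -> {poly R}).

Definition level_index : finType :=
  ('I_(spline_dim p r.+1 s) + 'I_(spline_dim p.-1 r s)
   + bool * ('I_(spline_dim p r s) * 'I_(spline_dim p r s)))%type.

Definition pull (k : level_index) : side -> R -> R -> R :=
  match k with
  | inl (inl i) => pull_gamma0 p r s beta i
  | inl (inr i) => pull_gamma1 p r s alpha i
  | inr (b, (i, j)) => pull_interior p r s (if b then PatchL else PatchR) i j
  end.

Definition side_bool (S : side) : bool := if S is PatchL then true else false.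

(** Collects a combination by the B-splines in the first variable: the [Gamma_0] functions
    contribute to [N_0] and [N_1], the [Gamma_1] functions to [N_1] only. *)
Lemma sum_pull (D : level_index -> R) (S : side) (y1 y2 : R) :
  (1 < spline_dim p r s)%N ->
  \sum_k D k * pull k S y1 y2 =
  \sum_(i < spline_dim p r s)
   (\sum_(j < spline_dim p r s)
      D (inr (side_bool S, (i, j))) * bspline p r s j y2
    + (val i == 0)%:R * (\sum_m D (inl (inl m)) * bspline p r.+1 s m y2)
    + (val i == 1)%:R *
       (\sum_m D (inl (inl m)) * (bspline p r.+1 s m y2
          + (beta S).[y2] * derive01 (bspline p r.+1 s m : R -> R^o) y2
            * (s`_0 / p%:R))
        + (alpha S).[y2] * \sum_m D (inl (inr m)) * bspline p.-1 r s m y2))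
   * bspline p r s i y1.
Proof.
move=> n1; have n0 := ltnW n1.
have pick (m : nat) (e : R) : (m < spline_dim p r s)%N ->
    \sum_(i < spline_dim p r s) (val i == m)%:R * e * bspline p r s i y1
    = e * bspline p r s m y1.
  move=> mn; rewrite (bigD1 (Ordinal mn)) //= eqxx mul1r big1 ?addr0 // => i.
  by rewrite -val_eqE /= => /negbTE ->; rewrite !mul0r.
under [RHS]eq_bigr do rewrite !mulrDl.
rewrite !big_split /= pick // pick // big_sumType /= big_sumType /=.
rewrite -[RHS]addrA [RHS]addrC; congr (_ + _).
  rewrite mulrDl addrA; congr (_ + _).
    rewrite !mulr_suml -big_split /=; apply: eq_bigr => m _.
    by rewrite /pull_gamma0; ring.
  rewrite mulr_sumr mulr_suml; apply: eq_bigr => m _.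
  by rewrite /pull_gamma1; ring.
transitivity (\sum_b \sum_i \sum_j
    D (inr (b, (i, j))) * pull (inr (b, (i, j))) S y1 y2).
  under [RHS]eq_bigr do rewrite pair_bigA.
  by rewrite pair_bigA; apply: eq_bigr => -[b [i j]].
rewrite (bigD1 (side_bool S)) //= [X in _ + X]big1 ?addr0.
  apply: eq_bigr => i _; rewrite mulr_suml; apply: eq_bigr => j _.
  rewrite /pull_interior asboolT; first by ring.
  by case: S.
move=> b bS; apply: big1 => i _; apply: big1 => j _.
by rewrite /pull_interior asboolF ?mulr0 //; case: S b bS => -[].
Qed.

Hypotheses (s1 : internal_breakpoints s) (s0 : (0 < size s)%N).
Hypotheses (hr : (1 < p - r)%N).
Hypothesis alpha0 : forall S v, 0 <= v <= 1 -> (alpha S).[v] != 0.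

Lemma pull_locally_indep (D : level_index -> R) (S : side) (x1 x2 : R) :
  0 <= x1 <= 1 -> 0 <= x2 <= 1 ->
  (forall b i j, (val i < 2)%N -> D (inr (b, (i, j))) = 0) ->
  (\forall y1 \near germ x1 & y2 \near germ x2,
     \sum_k D k * pull k S y1 y2 = 0) ->
  forall k, pull k S x1 x2 != 0 -> D k = 0.
Proof.
move=> hx1 hx2 D2 [[A1 A2] /= [hA1 hA2] hD].
have n1 : (1 < spline_dim p r s)%N by rewrite /spline_dim; nia.
have n0 := ltnW n1.
have [j1 [hj1 tj1 z1 I1]] := @bspline_locally_indep _ p r s x1 s1 hx1.
have [j2 [hj2 tj2 z2 I2]] := @bspline_locally_indep _ p r s x2 s1 hx2.
have [j0 [hj0 tj0 zM IM]] := @bspline_locally_indep _ p r.+1 s x2 s1 hx2.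
have [j3 [hj3 tj3 zK IK]] := @bspline_locally_indep _ p.-1 r s x2 s1 hx2.
have act (B : nat -> R -> R) (x : R) (j q : nat) :
    (forall i, ~~ (i <= j <= i + q)%N -> B i x = 0 /\
         \forall y \near germ x, B i y = 0) ->
    forall i, B i x != 0 -> (i <= j <= i + q)%N.
  by move=> zB i; apply: contra_neqT => /zB[].
pose A y2 := \sum_m D (inl (inl m)) * bspline p r.+1 s m y2.
pose A' y2 := \sum_m D (inl (inl m)) * (bspline p r.+1 s m y2
          + (beta S).[y2] * derive01 (bspline p r.+1 s m : R -> R^o) y2
            * (s`_0 / p%:R)).
pose K y2 := \sum_m D (inl (inr m)) * bspline p.-1 r s m y2.
pose E i y2 := \sum_j D (inr (side_bool S, (i, j))) * bspline p r s j y2.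
(* With [y2] frozen, independence in the first variable annihilates the coefficient of each active
   B-spline. *)
have hE (i : 'I_(spline_dim p r s)) : (i <= j1 <= i + p)%N ->
    \forall y2 \near germ x2, E i y2 + (val i == 0)%:R * A y2
      + (val i == 1)%:R * (A' y2 + (alpha S).[y2] * K y2) = 0.
  move=> hi; apply: filterS hA2 => y2 y2A; apply: (I1 (fun i => E i y2
    + (val i == 0)%:R * A y2
    + (val i == 1)%:R * (A' y2 + (alpha S).[y2] * K y2))) (hi) => //.
  apply: filterS hA1 => y1 y1A.
  by rewrite -(sum_pull _ _ _ _ n1); apply: (hD (y1, y2)).
have E0 (i : 'I_(spline_dim p r s)) y2 : (val i < 2)%N -> E i y2 = 0.
  by move=> i2; apply: big1 => j _; rewrite D2 // mul0r.
(* The knots p+1 and p+2 coincide, so the first two B-splines have the same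
   support, the first span. *)
have act01 : ((0 <= j1 <= 0 + p) || (1 <= j1 <= 1 + p))%N -> j1 = p.
  move=> h; have : j1 <> p.+1; last by move: h (andP hj1).1; clear; lia.
  move=> j1E; move: tj1; rewrite j1E.
  by rewrite -(addn0 p.+1) -addnS !open_knots_first ?ltxx // (ltnW hr).
(* The coefficient of [N_0] contains only [A], which has no derivative and no gluing polynomial. *)
have hA : j1 = p -> forall m : 'I_(spline_dim p r.+1 s),
    (m <= j0 <= m + p)%N -> D (inl (inl m)) = 0.
  move=> j1E m hm; apply: (IM (fun m => D (inl (inl m)))) (hm).
  have := hE (Ordinal n0); rewrite j1E leqnn /= => /(_ isT).
  by apply: filterS => y2; rewrite E0 // mul0r mul1r add0r addr0.
case=> [[m|m]|[b [i j]]] /=.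
- rewrite /pull_gamma0 => h; have j1E : j1 = p.
    apply: act01; apply/orP; have [N0|N0] := eqVneq (bspline p r s 0 x1) 0.
      right; apply: act z1 _ _; apply: contra_neq h => N1.
      by rewrite N0 N1 addr0 !mulr0 addr0.
    by left; apply: act z1 _ N0.
  apply: hA => //; apply: contra_neqT h => /zM[M0 M0'].
  by rewrite M0 derive01_eq0 // !(mul0r, mulr0) addr0.
- rewrite /pull_gamma1 => h.
  have N1 : bspline p r s 1 x1 != 0.
    by apply: contra_neq h => ->; rewrite mulr0.
  have Km : bspline p.-1 r s m x2 != 0.
    by apply: contra_neq h => ->; rewrite mulr0 mul0r.
  have j1E : j1 = p by apply: act01; apply/orP; right; apply: act z1 _ N1.
  apply: (IK (fun m => D (inl (inr m)))); last exact: act zK _ Km.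
  (* In [A'] the active terms have zero coefficient by [hA]; the inactive B-splines vanish on the
     germs of all nearby points, hence so do their derivatives. *)
  have A'0 : \forall y2 \near germ x2, A' y2 = 0.
    have h01 := germ01 hx2.
    have M0 : \forall y2 \near germ x2, forall m : 'I_(spline_dim p r.+1 s),
        ~~ (m <= j0 <= m + p)%N ->
        bspline p r.+1 s m y2 = 0 /\
        \forall z \near germ y2, bspline p r.+1 s m z = 0.
      apply: filter_forall => m'; have [act_m|/[dup] nact /zM[_ M0]] :=
        boolP (m' <= j0 <= m' + p)%N; first exact: nearW.
      have M0' := near_germ_germ hx2 M0.
      by near=> y2; split; near: y2.
    near=> y2; apply: big1 => m' _.
    have [act_m|nact_m] := boolP (m' <= j0 <= m' + p)%N.
      by rewrite (hA j1E) ?mul0r.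
    have /(_ m' nact_m)[M1 M1'] : forall m : 'I_(spline_dim p r.+1 s),
        ~~ (m <= j0 <= m + p)%N ->
        bspline p r.+1 s m y2 = 0 /\
        \forall z \near germ y2, bspline p r.+1 s m z = 0 by near: y2.
    have /andP[y20 y21] : 0 < y2 < 1 by near: y2.
    by rewrite M1 derive01_eq0 ?ltW // !(mul0r, mulr0) addr0 mulr0.
  (* With [A'] gone, the coefficient of [N_1] leaves [alpha * K = 0], and [alpha] has no zero on
     [[0, 1]]. *)
  have := hE (Ordinal n1); rewrite j1E /= leq_addl => h1.
  have p0 : (0 < p)%N := leq_trans (ltnW hr) (leq_subr _ _).
  move: h1; rewrite p0 => /(_ isT) h1; have h01 := germ01 hx2.
  near=> y2.
  have y01 : 0 < y2 < 1 by near: y2.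
  have : E (Ordinal n1) y2 + 0%:R * A y2
      + 1%:R * (A' y2 + (alpha S).[y2] * K y2) = 0 by near: y2.
  have -> : A' y2 = 0 by near: y2.
  rewrite E0 // mul0r mul1r !add0r => /eqP; rewrite mulf_eq0.
  rewrite (negbTE (alpha0 _ _)) => [/eqP //|].
  by case/andP: y01 => *; rewrite !ltW.
rewrite /pull_interior; case: asboolP => [bS|]; last by rewrite eqxx.
rewrite mulf_eq0 negb_or => /andP[Ni Nj].
have [i2|i2] := ltnP i 2; first exact: D2.
have -> : b = side_bool S by rewrite bS; case: (b).
apply: (I2 (fun j => D (inr (side_bool S, (i, j))))); last exact: act z2 _ Nj.
have := hE i (act _ _ _ _ z1 _ Ni); apply: filterS => y2.
rewrite (_ : val i == 0 = false); last by apply/eqP => /= i0; rewrite i0 in i2.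
rewrite (_ : val i == 1 = false); last by apply/eqP => /= i0; rewrite i0 in i2.
by rewrite !mul0r !addr0.
Unshelve. all: by end_near. Qed.
End LocalIndependence.

(** * Independence of the hierarchy *)

(** Transports the open complement of the next subdomain back to a product of germs in the parameter
    square. *)
Lemma tensor_spline_cvg (R : realType) (p r : nat) (s : seq R)
    (f : R * R -> 'rV[R]_2) (x1 x2 : R) :
  internal_breakpoints s -> tensor_spline p r s f ->
  0 <= x1 <= 1 -> 0 <= x2 <= 1 ->
  f y @[y --> filter_prod (germ x1) (germ x2)] --> f (x1, x2).
Proof.
move=> s1 [c fE] hx1 hx2; rewrite fE; last by split; rewrite /= in_itv.
have h1 := germ01 hx1; have h2 := germ01 hx2.
have c1 i : bspline p r s i y.1 @[y --> filter_prod (germ x1) (germ x2)]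
    --> bspline p r s i x1.
  apply: (@cvg_comp _ _ _ fst (bspline p r s i) _ (germ x1)).
    exact: cvg_fst.
  exact: bspline_cvg.
have c2 i : bspline p r s i y.2 @[y --> filter_prod (germ x1) (germ x2)]
    --> bspline p r s i x2.
  apply: (@cvg_comp _ _ _ snd (bspline p r s i) _ (germ x2)).
    exact: cvg_snd.
  exact: bspline_cvg.
apply: (@cvg_trans _ ((fun y : R * R => \sum_(i < spline_dim p r s)
    \sum_(j < spline_dim p r s)
      (bspline p r s i y.1 * bspline p r s j y.2) *: c i j)
    @ filter_prod (germ x1) (germ x2))); last first.
  apply: cvg_big => [|i _]; first exact: add_continuous.
  apply: cvg_big => [|j _]; first exact: add_continuous.
  by apply: cvgZr_tmp; apply: cvgM.
apply: near_eq_cvg; exists ([set y | 0 < y < 1], [set y | 0 < y < 1]) => //.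
move=> [y1 y2] [/= /andP[? ?] /andP[? ?]]; rewrite fE //.
by split; rewrite /= in_itv /= !ltW.
Qed.

Lemma Phi_pull (R : realType) (p r : nat) (tau : seq R)
    (F : side -> R * R -> 'rV[R]_2) (alpha beta : side -> {poly R}) (l : nat)
    (phi : set_type (Omega F) -> R^o) :
  Phi p r tau alpha beta l phi ->
  exists k : level_index p r (breakpoints tau l),
    has_pullbacks (pull alpha beta k) phi /\
    forall b i j, k = inr (b, (i, j)) -> (2 <= i)%N.
Proof.
have int S' b : (if b then PatchL else PatchR) = S' ->
    Phi_interior p r (breakpoints tau l) S' phi ->
  exists k : level_index p r (breakpoints tau l),
    has_pullbacks (pull alpha beta k) phi /\
    forall b i j, k = inr (b, (i, j)) -> (2 <= i)%N.
  move=> bS [i [j [/andP[i2 hi] hj h]]].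
  exists (inr (b, (Ordinal hi, Ordinal hj))); split; first by rewrite /= bS.
  by move=> _ _ _ [_ <- _].
move=> [[[|]|]|]; [exact: (int _ true)|exact: (int _ false)| |].
  by move=> [i hi h]; exists (inl (inl (Ordinal hi))); split.
by move=> [i hi h]; exists (inl (inr (Ordinal hi))); split.
Qed.

Lemma Omega_pull (R : realType) (F : side -> R * R -> 'rV[R]_2)
    (z : set_type (Omega F)) :
  exists S x, unit_square x /\ \val z = F S x.
Proof.
by have [[x hx e]|[x hx e]] := set_valP z; [exists PatchL, x|exists PatchR, x].
Qed.

Lemma has_pullbacks_inj (R : realType) (F : side -> R * R -> 'rV[R]_2)
    (g : side -> R -> R -> R) (phi psi : set_type (Omega F) -> R^o) :
  has_pullbacks g phi -> has_pullbacks g psi -> phi = psi.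
Proof.
move=> h1 h2; apply/funext => z; have [S [x [hx zx]]] := Omega_pull z.
by rewrite (h1 S x z) // (h2 S x z).
Qed.

Lemma hier_basis_lin_indep (R : realType) (p r : nat) (tau : seq R)
    (F : side -> R * R -> 'rV[R]_2) (alpha beta : side -> {poly R})
    (N : nat) (Om : nat -> set 'rV[R]_2) :
  (1 < p - r)%N -> (0 < size tau)%N -> internal_breakpoints tau ->
  (forall S, tensor_spline p r tau (F S)) ->
  (forall S v, 0 <= v <= 1 -> (alpha S).[v] != 0) ->
  Om 0%N = Omega F ->
  (forall l, (l <= N)%N -> closed (Om l)) ->
  (forall l, (l < N)%N -> Om l.+1 `<=` Om l) ->
  (0 < N)%N ->
  lin_indep (@hier_basis R p r tau F alpha beta N Om).
Proof.
move=> hr tau0 tau1 hF alpha0 Om0 Omcl Omnest N0 s c us hs sum0.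
have Omsub l m : (l <= m <= N)%N -> Om m `<=` Om l.
  elim: m => [|m IH] /andP[lm mN]; first by move: lm; rewrite leqn0 => /eqP ->.
  move: lm; rewrite leq_eqVlt => /predU1P[-> //|lm].
  apply: (subset_trans (Omnest _ mN)); apply: IH.
  by rewrite -ltnS lm ltnW.
have /choice[lv hlv] : forall v, exists l, v \in s ->
    [/\ (l <= N - 1)%N, Phi p r tau alpha beta l v,
     supp v `&` Om 0%N `<=` Om l & ~ supp v `&` Om 0%N `<=` Om l.+1].
  by move=> v; have [/hs[l hl]|_] := boolP (v \in s); [exists l|exists 0%N].
suff claim l : forall v, v \in s -> lv v = l -> c v = 0.
  by move=> v vs; apply: claim vs erefl.
elim/ltn_ind: l => l IH v0 v0s lv0.
have [lN v0P _ /existsNP[z0 /not_implyP[[z0supp _] z0Om]]] := hlv v0 v0s.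
rewrite lv0 in lN v0P z0Om.
set t := breakpoints tau l.
have t1 : internal_breakpoints t by apply: breakpoints_internal.
have t0 : (0 < size t)%N by apply: breakpoints_gt0.
have [k0 _] := Phi_pull v0P.
have /choice[kap hkap] : forall v, exists k : level_index p r t,
    v \in s -> lv v = l -> has_pullbacks (pull alpha beta k) v /\
      forall b i j, k = inr (b, (i, j)) -> (2 <= i)%N.
  move=> v; have [vs|_] := boolP (v \in s); last by exists k0.
  have [lvl|nl] := eqVneq (lv v) l; last first.
    by exists k0 => _ e; rewrite e eqxx in nl.
  have [_ + _ _] := hlv v vs; rewrite lvl => /Phi_pull[k hk].
  by exists k.
have Omopen : open (~` Om l.+1) by apply: closed_openC; apply: Omcl; lia.
(* The support is a closure, so the open complement of [Om l.+1] already meets the set where [v0] is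
   nonzero. *)
have [w [[z /= v0z zw] wOm]] := z0supp _ (open_nbhs_nbhs (conj Omopen z0Om)).
have [S [[x1 x2] [[/= hx1 hx2] zx]]] := Omega_pull z.
rewrite in_itv /= in hx1; rewrite in_itv /= in hx2.
pose D k := \sum_(v <- s | (lv v == l) && (kap v == k)) c v.
have D2 b i j : (val i < 2)%N -> D (inr (b, (i, j))) = 0.
  move=> i2; rewrite /D big_seq_cond big1 // => v /and3P[vs /eqP vl /eqP vk].
  by have [_ /(_ _ _ _ vk)] := hkap v vs vl; rewrite leqNgt i2.
(* An index determines its function through the pullbacks and [s] has no duplicates, so the sum
   defining [D (kap v0)] has a single term. *)
have Dv0 : D (kap v0) = c v0.
  rewrite /D big_mkcond (bigD1_seq v0) //= lv0 !eqxx /= big_seq_cond.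
  rewrite big1 ?addr0 // => v /andP[vs vv0].
  case: ifP => // /andP[/eqP vl /eqP vk]; case/eqP: vv0.
  apply: (@has_pullbacks_inj _ _ (pull alpha beta (kap v0))).
    by rewrite -vk; case: (hkap v vs vl).
  by case: (hkap v0 v0s lv0).
rewrite -Dv0; apply: (@pull_locally_indep _ p r t alpha beta t1 t0 hr alpha0 D S
  x1 x2 hx1 hx2 D2); last first.
  by case: (hkap v0 v0s lv0) => /(_ S (x1, x2) z _ zx) <-.
have Fcvg := tensor_spline_cvg tau1 (hF S) hx1 hx2.
have FOm : \forall y \near filter_prod (germ x1) (germ x2), ~ Om l.+1 (F S y).
  apply: (Fcvg (~` Om l.+1)); apply: open_nbhs_nbhs; split => //.
  by rewrite -zx zw.
have h1 := germ01 hx1; have h2 := germ01 hx2.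
have h12 : \forall y \near filter_prod (germ x1) (germ x2),
    unit_square y.
  exists ([set y | 0 < y < 1], [set y | 0 < y < 1]) => //.
  move=> [y1 y2] [/= /andP[? ?] /andP[? ?]].
  by split; rewrite /= in_itv /= !ltW.
apply: filterS2 FOm h12 => -[y1 y2] yOm yI /=.
have OmFy : Omega F (F S (y1, y2)).
  by case: (S) => /=; [left|right]; exists (y1, y2).
pose w' : set_type (Omega F) := SigSub (mem_set OmFy).
(* Coarser levels have zero coefficients by induction; a finer level is supported in [Om (lv v)],
   hence in [Om l.+1], which misses [w']. *)
have v_far v : v \in s -> lv v != l -> c v * v w' = 0.
  move=> vs; rewrite neq_ltn => /orP[vl|lvl].
    by rewrite (IH _ vl v vs) ?mul0r.
  have [vN _ vsupp _] := hlv v vs.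
  have [->|vw] := eqVneq (v w') 0; first by rewrite mulr0.
  exfalso; apply: yOm; apply: (Omsub l.+1 (lv v)).
    by rewrite lvl (leq_trans vN (leq_subr _ _)).
  apply: vsupp; split; last by rewrite Om0.
  by apply: subset_closure; exists w'.
have := congr1 (fun f => f w') sum0; rewrite fct_sumE /= => sumw.
rewrite -[RHS]sumw; transitivity (\sum_(v <- s | lv v == l) c v * v w').
  rewrite (partition_big kap xpredT) //=; apply: eq_bigr => k _.
  rewrite mulr_suml big_seq_cond [RHS]big_seq_cond.
  apply: eq_bigr => v /and3P[vs /eqP vl /eqP vk].
  have [/(_ S (y1, y2) w' yI erefl) -> _] := hkap v vs vl.
  by rewrite vk.
rewrite [RHS](bigID (fun v => lv v == l)) /= [X in _ = _ + X]big_seq_cond.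
by rewrite [X in _ = _ + X]big1 ?addr0 // => v /andP[]; apply: v_far.
Qed.

Theorem theorem1 (R : realType) (k p r : nat) (tau : k.-tuple R)
    (hk : (0 < k)%N) (hp : (3 <= p)%N) (hr : (1 <= r <= p - 2)%N)
    (htau : internal_breakpoints tau)
    (F : side -> R * R -> 'rV[R]_2)
    (hF : two_patch_geometry p r tau F)
    (hAS : analysis_suitable_G1 F)
    (alpha beta : side -> {poly R})
    (hgl : minimal_gluing_data F alpha beta)
    (N : nat) (hN : (1 <= N)%N)
    (Om : nat -> set 'rV[R]_2)
    (hOm0 : Om 0%N = Omega F)
    (hOmclosed : forall l : nat, (l <= N - 1)%N -> closed (Om l))
    (hOmnested : forall l : nat, (l.+1 <= N - 1)%N -> Om l.+1 `<=` Om l)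
    (hOmN : Om N = set0) :
  is_basis (@hier_basis R p r tau F alpha beta N Om)
           (@hier_space R p r tau F alpha beta N Om).
Proof.
(* The spanning half holds by definition of [hier_space]. *)
split=> //; apply: hier_basis_lin_indep => //.
- by lia.
- by rewrite size_tuple.
- exact: geometry_spline hF.
- move=> S v v01.
  have /(alpha_opposite hgl.1) : v \in `[0, 1] by rewrite in_itv.
  by move=> h; case: S; apply: contraTneq h => ->; rewrite ?mul0r ?mulr0 ltxx.
(* The empty set [Om N] extends closedness, and then nestedness, to the last index. *)
- move=> l; rewrite leq_eqVlt => /predU1P[->|lN].
    by rewrite hOmN; exact: closed0.
  by apply: hOmclosed; lia.
- move=> l lN; have [->|lN'] := eqVneq l.+1 N; first by rewrite hOmN.
  by apply: hOmnested; lia.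
Qed.
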